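(* If $\alpha\in\mathrm{Hom}(U,W)$ is injective, then $\ell(\alpha,0)$ is an affine regulus (with respect to $\mathrm{im}(\alpha)$) in the projective subspace $\mathbb P(K,\mathrm{im}(\alpha)\oplus U)$ of $\mathbb P(K,V)$. The associated regulus $\ell(\alpha,0)\cup\{\mathrm{im}(\alpha)\}$ is the unique regulus in $\mathbb P(K,\mathrm{im}(\alpha)\oplus U)$ containing $\mathrm{im}(\alpha)$, $U$, and $U^{(\alpha,1)}$ that has a transversal set $\mathcal T$ satisfying $$\{\mathrm{im}(\alpha)+T\mid T\in\mathcal T\}=\{\mathrm{im}(\alpha)+P\mid P\in\mathcal Z(U)\}.$$
   Context: $K$ is a not necessarily commutative field (division ring) with center $Z$, $V$ is a left vector space over $K$ of arbitrary dimension, $W\le V$ is a subspace with $W\ne\{0\}$, $W\neq V$, $U\le V$ is a fixed complement of $W$ ($V=W\oplus U$), and $(b_i)_{i\in I}$ is a fixed basis of $U$. Linear maps are written as exponents on the right and composed from left to right. For $\gamma\in\mathrm{Hom}(U,W)$ put $U^{(\gamma,1)}:=\{u^\gamma+u\mid u\in U\}$. For $k\in K$ let $\lambda_k\in\mathrm{End}(U)$ be the $K$-linear map with $b_i\mapsto kb_i$. For $0\neq\alpha\in\mathrm{Hom}(U,W)$ put $\ell(\alpha,0):=\{U^{(\lambda_k\alpha,1)}\mid k\in K\}$ (a line in the affine space on the set of complements of $W$ determined by the vector space structure $U^{(\gamma,1)}+U^{(\eta,1)}=U^{(\gamma+\eta,1)}$, $k\cdot U^{(\gamma,1)}=U^{(\lambda_k\gamma,1)}$).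 $\mathbb P(K,Y)$ is the projective space of subspaces of $Y$ (points and lines are the subspaces of dimension one and two). A regulus in $\mathbb P(K,Y)$ is a set of subspaces of $Y$ which, for some nonzero left $K$-vector space $X$ with a basis $(x_j)_{j\in J}$ and some $K$-linear bijection $X\times X\to Y$, is the image of the standard regulus $\{X\times\{0\}\}\cup\{\{(x^{\lambda_k},x)\mid x\in X\}\mid k\in K\}$, where here $\lambda_k\in\mathrm{End}(X)$ is the linear map with $x_j\mapsto kx_j$ (this notion does not depend on the chosen basis). If $A\le Y$ is an element of a regulus $\mathcal R$, then $\mathcal R\setminus\{A\}$ is called an affine regulus (with respect to $A$). A transversal of a regulus is a line of $\mathbb P(K,Y)$ meeting each of its elements in exactly one point; the transversal set is the set of all transversals. $\mathcal Z(U)$ is the set of all points $Kz$, where $z\neq0$ is a linear combination of the $b_i$ with coefficients in $Z$. *)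

(* Defs.v *)
From HB Require Import structures.
From mathcomp Require Import all_boot all_algebra finmap.
From mathcomp Require Import boolp classical_sets functions cardinality fsbigop.

Set Implicit Arguments.
Unset Strict Implicit.
Unset Printing Implicit Defensive.
Import GRing.Theory.
Local Open Scope classical_set_scope.
Local Open Scope ring_scope.

Definition center (K : nzRingType) : set K := [set z | forall k, GRing.comm z k].
Arguments center : clear implicits.

Section Bases.
Variables (K : nzRingType) (X : lmodType K) (J : choiceType) (x : J -> X).
Implicit Types (c : J -> K) (k : K).

Definition finsupp c := finite_set [set j | c j != 0].

Definition lincomb c : X := \sum_(j \in [set: J]) c j *: x j.

Definition free := forall c, finsupp c -> lincomb c = 0 -> forall j, c j = 0.

Definition span : set X := [set lincomb c | c in finsupp].

Definition basis := free /\ span = [set: X].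

Lemma lincombE (s : {fset J}) c :
  (forall j, c j != 0 -> j \in s) -> lincomb c = \sum_(j <- s) c j *: x j.
Proof.
move=> cs; apply: fsbigTE => j; apply: contraNeq => jx.
by apply: cs; apply: contra_neq jx => ->; rewrite scale0r.
Qed.

Lemma finsuppP c (fc : finsupp c) j : c j != 0 -> j \in fset_set [set j | c j != 0].
Proof. by move=> cj; rewrite in_fset_set// mem_set. Qed.

Lemma finsuppS c c' : (forall j, c j = 0 -> c' j = 0) -> finsupp c -> finsupp c'.
Proof.
move=> cc'; apply: sub_finite_set => j /=; apply: contra_neq; exact: cc'.
Qed.

Lemma finsuppD a c c' : finsupp c -> finsupp c' -> finsupp (fun j => a * c j + c' j).
Proof.
move=> fc fc'.
have : finite_set ([set j | c j != 0] `|` [set j | c' j != 0]).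
  by rewrite finite_setU.
apply: sub_finite_set => j /= h; case: (eqVneq (c j) 0) => [c0|]; last by left.
by right; move: h; rewrite c0 mulr0 add0r.
Qed.

Lemma lincombP k a c c' : finsupp c -> finsupp c' ->
  lincomb (fun j => (a * c j + c' j) * k) =
  a *: lincomb (fun j => c j * k) + lincomb (fun j => c' j * k).
Proof.
move=> fc fc'.
pose s := (fset_set [set j | c j != 0%R] `|` fset_set [set j | c' j != 0%R])%fset.
have sc j : c j * k != 0 -> j \in s.
  move=> h; rewrite in_fsetU (finsuppP fc)//.
  by apply: contra_neq h => ->; rewrite mul0r.
have sc' j : c' j * k != 0 -> j \in s.
  move=> h; rewrite in_fsetU (finsuppP fc') ?orbT//.
  by apply: contra_neq h => ->; rewrite mul0r.
rewrite !(@lincombE s)//; last first.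
  move=> j h; case: (eqVneq (c j * k) 0) => [ck|/sc//].
  by apply: sc'; move: h; rewrite mulrDl -mulrA ck mulr0 add0r.
rewrite scaler_sumr -big_split/=; apply: eq_bigr => j _.
by rewrite mulrDl scalerDl -mulrA scalerA.
Qed.

Lemma lambda_exists k : basis ->
  exists f : {linear X -> X}, forall j, f (x j) = k *: x j.
Proof.
move=> [fx sx].
have sxu u : exists c, finsupp c /\ lincomb c = u.
  have : span u by rewrite sx.
  by case=> c fc <-; exists c.
pose c u := sval (cid (sxu u)).
have fc u : finsupp (c u) by rewrite /c; case: cid => ? [].
have cK u : lincomb (c u) = u by rewrite /c; case: cid => ? [].
have lin1 a d d' : finsupp d -> finsupp d' ->
    lincomb (fun j => a * d j + d' j) = a *: lincomb d + lincomb d'.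
  move=> fd fd'; have := lincombP 1 a fd fd'.
  by under eq_fun do rewrite mulr1; under [X in _ *: lincomb X]eq_fun do rewrite mulr1;
     under [X in _ + lincomb X]eq_fun do rewrite mulr1.
have cU u d : finsupp d -> lincomb d = u -> d = c u.
  move=> fd du; apply/funext => j; apply/esym/eqP.
  have := fx (fun j => (-1) * d j + c u j) (finsuppD _ fd (fc u)).
  rewrite lin1// du cK scaleN1r addNr => /(_ erefl j) /eqP.
  by rewrite mulN1r addrC subr_eq0.
pose f u := lincomb (fun j => c u j * k).
have fl : linear f.
  move=> a u v; rewrite /f -lincombP//; congr lincomb; apply/funext => j.
  by rewrite -(cU (a *: u + v) (fun j => a * c u j + c v j)) ?lin1 ?cK//; exact: finsuppD.
pose fL := GRing.isLinear.Build K X X *:%R f fl.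
pose F : {linear X -> X} := HB.pack f fL.
exists F => j; rewrite /= /f.
have fd : finsupp (fun i => (i == j)%:R).
  apply: (sub_finite_set _ (finite_set1 j)) => i /=.
  by case: (eqVneq i j) => //; rewrite eqxx.
have lE a : lincomb (fun i => (i == j)%:R * a) = a *: x j.
  rewrite (@lincombE [fset j]%fset); first by rewrite big_seq_fset1 eqxx mul1r.
  by move=> i; rewrite in_fset1; case: (i == j) => //; rewrite mul0r eqxx.
rewrite -(cU (x j) (fun i => (i == j)%:R))//.
by have := lE 1; rewrite scale1r; under eq_fun do rewrite mulr1.
Qed.

(* The linear map sending each x j to k *: x j (the identity if there is no
   such map, which [lambdaE] excludes when x is a basis). *)
Definition lambda k : {linear X -> X} :=
  if pselect (exists f : {linear X -> X}, forall j, f (x j) = k *: x j) is left e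
  then sval (cid e) else idfun.

Lemma lambdaE k j : basis -> lambda k (x j) = k *: x j.
Proof.
by move=> /(lambda_exists k) e; rewrite /lambda; case: pselect => // e'; case: cid.
Qed.

End Bases.

Section Subspaces.
Variables (K : nzRingType) (V : lmodType K).

(* The vector space structure of a subspace. *)
Record subvect (S : submodClosed V) := SubVect { vec : V; vecP : vec \in S }.

Definition sumset (A B : set V) : set V := [set a + b | a in A & b in B].

Definition has_dim (n : nat) (A : set V) :=
  exists2 v : 'I_n -> V, free v & span v = A.

Definition point (P : set V) := has_dim 1 P.
Definition line (L : set V) := has_dim 2 L.

Definition standard_regulus (X : lmodType K) (J : choiceType) (x : J -> X) :
    set (set (X * X)%type) :=
  [set [set p | p.2 = 0]] `|`
  [set [set (lambda x k y, y) | y in [set: X]] | k in [set: K]].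

Definition regulus (Y : set V) (R : set (set V)) :=
  exists (X : lmodType K) (J : choiceType) (x : J -> X)
    (f : {linear (X * X)%type -> V}),
    [/\ [set: X] <> [set 0], basis x, injective f, range f = Y &
        R = [set f @` A | A in standard_regulus x]].

Definition affine_regulus (Y A : set V) (S : set (set V)) :=
  exists R, [/\ regulus Y R, R A & S = R `\ A].

Definition transversals (Y : set V) (R : set (set V)) : set (set V) :=
  [set T | [/\ line T, T `<=` Y &
    forall A, R A -> exists! P, [/\ point P, P `<=` T & P `<=` A]]].

End Subspaces.

HB.instance Definition _ (K : nzRingType) (V : lmodType K) (S : submodClosed V) :=
  [isSub for @vec K V S].
HB.instance Definition _ (K : nzRingType) (V : lmodType K) (S : submodClosed V) :=
  [Choice of subvect S by <:].
HB.instance Definition _ (K : nzRingType) (V : lmodType K) (S : submodClosed V) :=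
  [SubChoice_isSubLmodule of subvect S by <:].

Section AffineLine.
Variables (K : nzRingType) (V : lmodType K) (W U : submodClosed V).
Variables (I : choiceType) (b : I -> subvect U).

Definition im (alpha : subvect U -> subvect W) : set V :=
  [set vec (alpha u) | u in [set: subvect U]].

Definition graph (gamma : subvect U -> subvect W) : set V :=
  [set vec (gamma u) + vec u | u in [set: subvect U]].

(* The line through [graph 0] = U with direction alpha. *)
Definition ell (alpha : subvect U -> subvect W) : set (set V) :=
  [set graph (alpha \o lambda b k) | k in [set: K]].

Definition central_points : set (set V) :=
  [set P | exists2 c : I -> K, finsupp c /\ (forall i, center K (c i)) &
     lincomb b c <> 0 /\ P = [set k *: vec (lincomb b c) | k in [set: K]]].

End AffineLine.

(* Main.v *)
From HB Require Import structures.
From mathcomp Require Import all_boot all_algebra finmap.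
From mathcomp Require Import boolp classical_sets cardinality fsbigop.
Require Import Defs.

Set Implicit Arguments.
Unset Strict Implicit.
Unset Printing Implicit Defensive.
Import GRing.Theory.
Local Open Scope classical_set_scope.
Local Open Scope ring_scope.

(** The parametrization f (u, v) = alpha u + v of Y = im alpha + U by U * U
carries the standard regulus to the set of im alpha, the image of U * {0}, and
of the graphs {alpha (u^lambda_k) + u}, which form ell b alpha.  Hence the
associated set is a regulus.

Everything else rests on the transversals of a regulus ([transversal_diagonal],
[diagonal_transversal]).  In the coordinates given by a basis x of X they are
the lines K a * K a, with a a nonzero combination of the x j with central
coefficients.  Indeed, a line meeting X * 0, 0 * X and the diagonal is of the
form K d * K d; it meets the graph of lambda_k only if lambda_k d is a multiple
of d.  If d is scaled so that some coordinate is 1, the multiplier must be k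
itself, and comparing the other coordinates shows that they commute with k.
Adding im alpha to such a line gives im alpha + K a, which is the condition on
the transversal set.

For uniqueness, let R' be another regulus that contains im alpha, U and the
graph of alpha and satisfies the condition.  For every nonzero z with central
coordinates some transversal T of R' has im alpha + T = im alpha + K z.  Since T
meets U and the graph of alpha, it contains z and alpha z
([transversal_through]).  So an element A of R' other than im alpha contains
some vector k (alpha z) + z ([element_meets_transversal]).  The scalar k is the
same for all basis vectors, as one sees by applying this to z = x i + x j and
using that A meets im alpha trivially; hence A is the graph belonging to k
([element_slope]).  So R' is contained in the associated regulus.  The two
coincide because the elements of R' cover each of its transversals
([transversal_cover]): the vector k (alpha z) + z lies in some element of R',
which can only be the graph belonging to k. *)

(** * Subspaces, points and lines over a division ring *)

Section Subspaces.
Variables (K : unitRingType) (K_div : GRing.field_axiom K) (V : lmodType K).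
Implicit Types (A B L T : set V) (u v w : V) (k s t : K).

(** Regulus elements and transversals are bare sets of vectors; this is the
closure property that they share. *)
Definition subspace A := A 0 /\ forall k u v, A u -> A v -> A (k *: u + v).

Lemma subspaceZ A k u : subspace A -> A u -> A (k *: u).
Proof. by move=> [A0 AD] Au; rewrite -[_ *: _]addr0; exact: AD. Qed.

Lemma subspaceD A u v : subspace A -> A u -> A v -> A (u + v).
Proof. by move=> [_ AD] Au Av; rewrite -[u]scale1r; exact: AD. Qed.

Lemma subspaceB A u v : subspace A -> A u -> A v -> A (u - v).
Proof. by move=> [_ AD] Au Av; rewrite -scaleN1r addrC; exact: AD. Qed.

Lemma scalerVK k u : k != 0 -> k^-1 *: (k *: u) = u.
Proof. by move=> /K_div k0; rewrite scalerA mulVr// scale1r. Qed.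

Lemma subspaceZ_inv A k u : subspace A -> k != 0 -> A (k *: u) -> A u.
Proof. by move=> sA k0 /(subspaceZ k^-1 sA); rewrite scalerVK. Qed.

Lemma scaler_neq0 k u : k *: u != 0 -> k != 0 /\ u != 0.
Proof.
by move=> ku; split; apply: contra_neq ku => ->; rewrite ?scale0r ?scaler0.
Qed.

Definition ray v : set V := [set k *: v | k in [set: K]].

Lemma ray_subspace v : subspace (ray v).
Proof.
split=> [|k _ _ [s _ <-] [t _ <-]]; first by exists 0; rewrite ?scale0r.
by exists (k * s + t) => //; rewrite scalerDl scalerA.
Qed.

Lemma ray_id v : ray v v.
Proof. by exists 1; rewrite ?scale1r. Qed.

Lemma ray_sub A v : subspace A -> A v -> ray v `<=` A.
Proof. by move=> sA Av _ [k _ <-]; exact: subspaceZ. Qed.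

Lemma ray_eq v w : w != 0 -> ray v w -> ray w = ray v.
Proof.
move=> w0 vw; apply/seteqP; split; apply: ray_sub => //; try exact: ray_subspace.
case: vw w0 => k _ <- /scaler_neq0[k0 _].
by apply: (subspaceZ_inv (ray_subspace _) k0); exact: ray_id.
Qed.

Lemma sumset_subspace A B : subspace A -> subspace B -> subspace (sumset A B).
Proof.
move=> sA sB; split; first by exists 0; [exact: sA.1|exists 0; [exact: sB.1|rewrite addr0]].
move=> k _ _ [a Aa [b Bb <-]] [a' Aa' [b' Bb' <-]].
exists (k *: a + a'); first exact: sA.2.
exists (k *: b + b'); first exact: sB.2.
by rewrite scalerDr addrACA.
Qed.

Lemma sumsetl A B a : subspace B -> A a -> sumset A B a.
Proof. by move=> [B0 _] Aa; exists a => //; exists 0 => //; rewrite addr0. Qed.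

Lemma sumsetr A B b : subspace A -> B b -> sumset A B b.
Proof. by move=> [A0 _] Bb; exists 0 => //; exists b => //; rewrite add0r. Qed.

Lemma sumset_sub A B C : subspace C -> A `<=` C -> B `<=` C -> sumset A B `<=` C.
Proof.
by move=> sC AsC BsC _ [a Aa [b Bb <-]]; apply: subspaceD => //; [exact: AsC|exact: BsC].
Qed.

Lemma lincomb_fin (n : nat) (v : 'I_n -> V) (c : 'I_n -> K) : lincomb v c = \sum_i c i *: v i.
Proof.
rewrite /lincomb -[RHS]big_enum/= (fsbig_seq _ _ (enum_uniq _)); apply: eq_fsbigl.
by apply/seteqP; split=> j //= _; rewrite mem_enum.
Qed.

Lemma pointP P : point P <-> exists2 v, v != 0 & P = ray v.
Proof.
have span1 (v : 'I_1 -> V) : span v = ray (v ord0).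
  apply/seteqP; split=> [_ [c _ <-]|_ [k _ <-]].
    by exists (c ord0) => //; rewrite lincomb_fin big_ord1.
  by exists (fun=> k); rewrite ?lincomb_fin ?big_ord1//; exact: finite_finset.
split=> [[v fv <-]|[v v0 ->]].
  exists (v ord0); last exact: span1.
  apply/eqP => v0; have := fv (fun=> 1) finite_finset.
  by rewrite lincomb_fin big_ord1 v0 scaler0 => /(_ erefl ord0)/eqP; rewrite oner_eq0.
exists (fun=> v); last exact: span1.
move=> c _; rewrite lincomb_fin big_ord1 => cv j; rewrite (ord1 j).
by apply: contra_neq_eq v0 => c0; rewrite -(scalerVK v c0) cv scaler0.
Qed.

Lemma lineP L : line L <-> exists v w,
  (forall s t, s *: v + t *: w = 0 -> s = 0 /\ t = 0) /\ L = sumset (ray v) (ray w).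
Proof.
have lincomb2 (v : 'I_2 -> V) c :
    lincomb v c = c ord0 *: v ord0 + c ord_max *: v ord_max.
  rewrite lincomb_fin big_ord_recl big_ord1; congr (_ + c _ *: v _); exact: val_inj.
have span2 (v : 'I_2 -> V) : span v = sumset (ray (v ord0)) (ray (v ord_max)).
  apply/seteqP; split=> [_ [c _ <-]|_ [_ [s _ <-] [_ [t _ <-] <-]]].
    exists (c ord0 *: v ord0); first by exists (c ord0).
    by exists (c ord_max *: v ord_max); [exists (c ord_max)|rewrite lincomb2].
  exists (fun j => if j == ord0 then s else t); first exact: finite_finset.
  by rewrite lincomb2.
split=> [[v fv <-]|[v [w [fvw ->]]]].
  exists (v ord0), (v ord_max); split=> // s t st.
  have := fv (fun j => if j == ord0 then s else t) finite_finset.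
  by rewrite lincomb2/= => /(_ st) c0; split; [exact: (c0 ord0)|exact: (c0 ord_max)].
exists (fun j => if j == ord0 then v else w); last by rewrite span2.
move=> c _; rewrite lincomb2/= => /fvw[c0 c1] j.
by case: (unliftP ord0 j) => [i ->|->//]; rewrite (ord1 i) -c1; congr c; exact: val_inj.
Qed.

Lemma line_subspace L : line L -> subspace L.
Proof.
by move=> /lineP[v [w [_ ->]]]; apply: sumset_subspace; exact: ray_subspace.
Qed.

(** Steinitz exchange, for spans of two vectors. *)
Lemma line_exchange v w p : p != 0 -> sumset (ray v) (ray w) p ->
  exists u, sumset (ray v) (ray w) = sumset (ray p) (ray u).
Proof.
move=> p0 pvw.
have svw := sumset_subspace (ray_subspace v) (ray_subspace w).
have [_ [s _ <-] [_ [t _ <-] pE]] := pvw.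
have [s0|s0] := eqVneq s 0.
  exists v; rewrite (@ray_eq w p) //; last by exists t => //; rewrite -pE s0 scale0r add0r.
  by apply/seteqP; split=> _ [a va [b wb <-]]; rewrite addrC; exists b => //; exists a.
exists w; apply/seteqP; split; apply: sumset_sub => //.
- by apply: sumset_subspace; exact: ray_subspace.
- apply: ray_sub; first by apply: sumset_subspace; exact: ray_subspace.
  exists (s^-1 *: p); first by exists s^-1.
  exists (- (s^-1 * t) *: w); first by exists (- (s^-1 * t)).
  by rewrite -pE scalerDr (scalerVK _ s0) scalerA scaleNr addrK.
- by move=> x wx; apply: sumsetr => //; exact: ray_subspace.
- exact: ray_sub.
- by move=> x wx; apply: sumsetr => //; exact: ray_subspace.
Qed.

Lemma line_span2 L p q : line L -> p != 0 -> L p -> L q -> ~ ray p q ->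
  L = sumset (ray p) (ray q).
Proof.
move=> /lineP[v [w [_ ->]]] p0 /(line_exchange p0)[u ->] pq npq.
have [_ [s _ <-] [_ [t _ <-] qE]] := pq.
have t0 : t != 0.
  by apply: contra_notN npq => /eqP t0; rewrite -qE t0 scale0r addr0; exists s.
have spq := sumset_subspace (ray_subspace p) (ray_subspace q).
apply/seteqP; split; apply: sumset_sub => //.
- by move=> x px; apply: sumsetl => //; exact: ray_subspace.
- apply: ray_sub => //; apply: (subspaceZ_inv spq t0).
  have -> : t *: u = - s *: p + q by rewrite -qE scaleNr addKr.
  by exists (- s *: p); [exists (- s)|exists q => //; exact: ray_id].
- by apply: sumset_subspace; exact: ray_subspace.
- by move=> x px; apply: sumsetl => //; exact: ray_subspace.
- by apply: ray_sub => //; apply: sumset_subspace; exact: ray_subspace.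
Qed.

(** Meeting in exactly one point means that the intersection is one-dimensional;
in this form the condition on transversals can be computed with. *)
Lemma unique_pointP A B : subspace A -> subspace B ->
  (exists! P, [/\ point P, P `<=` A & P `<=` B]) <->
  exists2 v, v != 0 & A `&` B = ray v.
Proof.
move=> sA sB; split=> [[P [[/pointP[v v0 PE] PA PB] PU]]|[v v0 AB]].
  exists v => //; apply/seteqP; split; last by move=> x; rewrite -PE => Px; split; auto.
  move=> x [Ax Bx]; have [->|x0] := eqVneq x 0; first exact: (ray_subspace v).1.
  rewrite -PE (PU (ray x)); first exact: ray_id.
  by split; [apply/pointP; exists x|exact: ray_sub|exact: ray_sub].
have [Av Bv] : (A `&` B) v by rewrite AB; exact: ray_id.
exists (ray v); split.
  by split; [apply/pointP; exists v|exact: ray_sub|exact: ray_sub].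
move=> _ [/pointP[w w0 ->] PA PB]; apply/esym/ray_eq => //; rewrite -AB.
by split; [exact/PA/ray_id|exact/PB/ray_id].
Qed.

Lemma transversal_meets (Y : set V) (R : set (set V)) T A :
  transversals Y R T -> R A -> subspace A -> exists2 v, v != 0 & T `&` A = ray v.
Proof.
move=> [lT _ TR] RA sA; apply: (unique_pointP (line_subspace lT) sA).1; exact: TR.
Qed.

End Subspaces.

(** * Coordinates and the maps lambda *)

Section Coordinates.
Variables (K : unitRingType) (K_div : GRing.field_axiom K) (X : lmodType K).
Variables (J : choiceType) (x : J -> X) (x_basis : basis x).
Implicit Types (c d : J -> K) (u v a : X) (k m : K).

Lemma coordsP u : exists2 c, finsupp c & lincomb x c = u.
Proof. by have : span x u by rewrite x_basis.2. Qed.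

Lemma lincombZ k c : finsupp c -> lincomb x (fun j => k * c j) = k *: lincomb x c.
Proof.
move=> fc; rewrite !(@lincombE _ _ _ x (fset_set [set j | c j != 0])).
- by rewrite scaler_sumr; apply: eq_bigr => j _; rewrite scalerA.
- exact: finsuppP.
- by move=> j h; apply: finsuppP => //; apply: contra_neq h => ->; rewrite mulr0.
Qed.

Lemma coord_neq0 c u : finsupp c -> lincomb x c = u -> u != 0 -> exists j, c j != 0.
Proof.
move=> fc uE u0; apply: contrapT => c0; move/eqP: u0; apply.
rewrite -uE -[LHS](_ : lincomb x (fun j => 0 * c j) = _); first by rewrite lincombZ// scale0r.
congr lincomb; apply/funext => j; rewrite mul0r; apply/eqP.
by case: eqVneq => // cj; case: c0; exists j; rewrite eq_sym.
Qed.

Lemma lincombD c d : finsupp c -> finsupp d ->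
  lincomb x (fun j => c j + d j) = lincomb x c + lincomb x d.
Proof.
move=> fc fd; have := lincombP x 1 1 fc fd; rewrite scale1r.
have h e : (fun j => e j * 1) = e :> (J -> K) by apply/funext => j; rewrite mulr1.
by rewrite !h => <-; congr lincomb; apply/funext => j; rewrite mul1r.
Qed.

Lemma lincomb_inj c d : finsupp c -> finsupp d -> lincomb x c = lincomb x d -> c =1 d.
Proof.
move=> fc fd cd j; apply/esym/eqP; rewrite -subr_eq0 -mulN1r addrC; apply/eqP.
apply: (x_basis.1 _ (finsuppD (-1) fc fd) _ j).
rewrite (@lincombD (fun j => -1 * c j))//; last first.
  by apply: finsuppS fc => i ->; rewrite mulr0.
by rewrite lincombZ// scaleN1r cd addNr.
Qed.

Lemma linear_lincomb (V : lmodType K) (g : {linear X -> V}) c : finsupp c ->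
  g (lincomb x c) = lincomb (g \o x) c.
Proof.
move=> fc; rewrite (@lincombE _ _ _ x (fset_set [set j | c j != 0])); last exact: finsuppP.
rewrite (@lincombE _ _ _ _ (fset_set [set j | c j != 0])); last exact: finsuppP.
by rewrite linear_sum; apply: eq_bigr => j _; rewrite linearZ.
Qed.

Lemma lambda_lincomb k c : finsupp c ->
  lambda x k (lincomb x c) = lincomb x (fun j => c j * k).
Proof.
move=> fc; rewrite linear_lincomb//.
rewrite !(@lincombE _ _ _ _ (fset_set [set j | c j != 0])).
- by apply: eq_bigr => j _; rewrite /= lambdaE// scalerA.
- by move=> j h; apply: finsuppP => //; apply: contra_neq h => ->; rewrite mul0r.
- exact: finsuppP.
Qed.

(** A subspace that contains the images of the basis vectors contains the whole
image; this is how an element of a regulus is recognized as a graph. *)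
Lemma linear_basis_sub (V : lmodType K) (A : set V) (g : {linear X -> V}) :
  subspace A -> (forall j, A (g (x j))) -> forall u, A (g u).
Proof.
move=> sA Ag u; have [c fc <-] := coordsP u; rewrite linear_lincomb//.
rewrite (@lincombE _ _ _ _ (fset_set [set j | c j != 0])); last exact: finsuppP.
by elim/big_rec: _ => [|j y _ Ay]; [exact: sA.1|apply: sA.2 => //; exact: Ag].
Qed.

Lemma lambda0 u : lambda x 0 u = 0.
Proof.
have [c fc <-] := coordsP u; rewrite lambda_lincomb//.
have -> : (fun j => c j * 0) = (fun j => 0 * c j) by apply/funext => j; rewrite mul0r mulr0.
by rewrite lincombZ// scale0r.
Qed.

Lemma lambda1 u : lambda x 1 u = u.
Proof.
have [c fc <-] := coordsP u; rewrite lambda_lincomb//.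
by congr lincomb; apply/funext => j; rewrite mulr1.
Qed.

Lemma lambda_inj k m u : u != 0 -> lambda x k u = lambda x m u -> k = m.
Proof.
move=> u0; have [c fc uE] := coordsP u; rewrite -uE !lambda_lincomb// => km.
have fcr n : finsupp (fun j => c j * n) by apply: finsuppS fc => j ->; rewrite mul0r.
have ckm := lincomb_inj (fcr k) (fcr m) km.
have [j cj] := coord_neq0 fc uE u0.
by rewrite -[k](mulKr (K_div cj)) ckm mulKr//; exact: K_div.
Qed.

Definition central_vector u :=
  exists2 c, finsupp c /\ (forall j, center K (c j)) & lincomb x c = u.

(** On coordinates lambda k multiplies by k on the right, scaling multiplies by
k on the left; they agree on central coordinates. *)
Lemma lambda_central k a : central_vector a -> lambda x k a = k *: a.
Proof.
move=> [c [fc cc] <-]; rewrite lambda_lincomb// -lincombZ//.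
by congr lincomb; apply/funext => j; exact: cc.
Qed.

Lemma lincomb_delta j :
  finsupp (fun i => (i == j)%:R : K) /\ lincomb x (fun i => (i == j)%:R) = x j.
Proof.
split.
  apply: (sub_finite_set _ (finite_set1 j)) => i /=.
  by case: (eqVneq i j) => //; rewrite eqxx.
rewrite (@lincombE _ _ _ _ [fset j]%fset); first by rewrite big_seq_fset1 eqxx scale1r.
by move=> i; rewrite in_fset1; case: (i == j) => //; rewrite eqxx.
Qed.

Lemma central_basis j : central_vector (x j).
Proof.
have [fd dE] := lincomb_delta j; exists (fun i => (i == j)%:R) => //.
by split=> // i k; case: (i == j); [exact/commr_sym/commr1|exact/commr_sym/commr0].
Qed.

(** Two distinct basis vectors are independent, in the form in which the scalars
belonging to different basis vectors are compared. *)
Lemma basis_scale_eq i j k m : i != j -> k *: x i = m *: x j -> k = 0.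
Proof.
move=> ij; have [[fi iE] [fj jE]] := (lincomb_delta i, lincomb_delta j).
rewrite -iE -jE -!lincombZ// => /lincomb_inj kim.
have := kim _ _ i; rewrite eqxx (negPf ij) mulr1 mulr0; apply.
  by apply: finsuppS fi => l ->; rewrite mulr0.
by apply: finsuppS fj => l ->; rewrite mulr0.
Qed.

Lemma basis_neq0 j : x j != 0.
Proof.
have [fj jE] := lincomb_delta j; apply/eqP => xj0.
have := x_basis.1 _ fj; rewrite jE => /(_ xj0 j)/eqP.
by rewrite eqxx oner_eq0.
Qed.

Lemma centralD a b : central_vector a -> central_vector b -> central_vector (a + b).
Proof.
move=> [c [fc cc] <-] [d [fd cd] <-]; exists (fun j => c j + d j); last exact: lincombD.
split; last by move=> j k; apply/commr_sym/commrD; apply/commr_sym; [exact: cc|exact: cd].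
have := finsuppD 1 fc fd; congr finsupp; apply/funext => j; by rewrite mul1r.
Qed.

(** Converse of [lambda_central] for rays.  Dividing by a nonzero coordinate makes
that coordinate 1, so that an equation lambda k a = m *: a forces m = k there
and then c i * k = k * c i in every other coordinate. *)
Lemma ray_central u : u != 0 -> (forall k, ray u (lambda x k u)) ->
  exists a, [/\ central_vector a, a != 0 & ray a = ray u].
Proof.
move=> u0 eig; have [c fc uE] := coordsP u.
have [j cj] := coord_neq0 fc uE u0.
pose a := (c j)^-1 *: u.
have au : ray u a by exists (c j)^-1.
have a0 : a != 0.
  apply: contra_neq u0 => a0.
  by rewrite -[u]scale1r -(mulrV (K_div cj)) -scalerA -/a a0 scaler0.
have ra := ray_eq K_div a0 au.
exists a; split=> //; pose d i := (c j)^-1 * c i.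
have fd : finsupp d by apply: finsuppS fc => i; rewrite /d => ->; rewrite mulr0.
have dE : lincomb x d = a by rewrite lincombZ// uE.
have dj : d j = 1 by rewrite /d mulVr//; exact: K_div.
have frd k : finsupp (fun i => d i * k) by apply: finsuppS fd => i ->; rewrite mul0r.
have fld k : finsupp (fun i => k * d i) by apply: finsuppS fd => i ->; rewrite mulr0.
exists d => //; split=> // i k.
have [m _ mE] : ray a (lambda x k a).
  rewrite ra /a linearZ; apply: subspaceZ; [exact: ray_subspace|exact: eig].
move: mE; rewrite -dE lambda_lincomb// -lincombZ// => /lincomb_inj h.
have md := h (fld m) (frd k).
by have := md j; rewrite dj mulr1 mul1r => mk; rewrite /GRing.comm -md mk.
Qed.

End Coordinates.

(** * Linear parametrizations by a square X * X *)

Section Parametrization.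
Variables (K : unitRingType) (K_div : GRing.field_axiom K) (X V : lmodType K).
Variables (f : {linear (X * X)%type -> V}) (f_inj : injective f).
Implicit Types (g h : {linear X -> X}) (u v a y : X) (k s t : K).

(** Image of X * {0}, the one element of the standard regulus that is not the
graph of a map. *)
Definition axis : set V := [set f (y, 0) | y in [set: X]].
(** The first component depends on the second one, as in the standard regulus. *)
Definition slope (g : X -> X) : set V := [set f (g y, y) | y in [set: X]].

Lemma param0 : f (0, 0) = 0.
Proof. exact: (linear0 f). Qed.

Lemma paramZ k u v : k *: f (u, v) = f (k *: u, k *: v).
Proof. by rewrite -linearZ. Qed.

Lemma paramD u v u' v' : f (u, v) + f (u', v') = f (u + u', v + v').
Proof. by rewrite -linearD. Qed.

Lemma paramB u v u' v' : f (u, v) - f (u', v') = f (u - u', v - v').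
Proof. by rewrite -linearB. Qed.

Lemma param_neq0 u v : (f (u, v) != 0) = (u != 0) || (v != 0).
Proof.
by rewrite -param0 (inj_eq f_inj) xpair_eqE negb_and.
Qed.

Lemma axisE u v : axis (f (u, v)) <-> v = 0.
Proof. by split=> [[y _ /f_inj[]]|->] //; exists u. Qed.

Lemma slopeE g u v : slope g (f (u, v)) <-> u = g v.
Proof. by split=> [[y _ /f_inj[<- <-]]|->] //; exists v. Qed.

Lemma axis_subspace : subspace axis.
Proof.
split=> [|k _ _ [y _ <-] [z _ <-]]; first by exists 0; rewrite ?param0.
by exists (k *: y + z); rewrite // paramZ paramD scaler0 addr0.
Qed.

Lemma slope_subspace g : subspace (slope g).
Proof.
split=> [|k _ _ [y _ <-] [z _ <-]]; first by exists 0; rewrite ?linear0 ?param0.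
by exists (k *: y + z); rewrite // paramZ paramD linearP.
Qed.

Definition diagonal_line a := sumset (ray (f (a, 0))) (ray (f (0, a))).

Lemma diagonal_lineP a w : diagonal_line a w <-> exists s t, w = f (s *: a, t *: a).
Proof.
split=> [[_ [s _ <-] [_ [t _ <-] <-]]|[s [t ->]]].
  by exists s, t; rewrite !paramZ paramD !scaler0 add0r addr0.
exists (s *: f (a, 0)); first by exists s.
exists (t *: f (0, a)); first by exists t.
by rewrite !paramZ paramD !scaler0 add0r addr0.
Qed.

Lemma line_diagonal a : a != 0 -> line (diagonal_line a).
Proof.
move=> a0; apply/lineP => //; exists (f (a, 0)), (f (0, a)); split=> // s t.
rewrite !paramZ paramD !scaler0 add0r addr0 => /eqP; rewrite -[_ == 0]negbK param_neq0.
rewrite negb_or !negbK => /andP[/eqP sa /eqP ta].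
by split; apply: contra_neq_eq a0 => r0; rewrite -(scalerVK K_div a r0) ?sa ?ta scaler0.
Qed.

Lemma line_diagonalE L a : line L -> a != 0 -> L (f (a, 0)) -> L (f (0, a)) ->
  L = diagonal_line a.
Proof.
move=> lL a0 L1 L2; apply: line_span2 => //; first by rewrite param_neq0 a0.
by move=> [k _]; rewrite paramZ scaler0 => /f_inj[_ /esym/eqP]; rewrite (negPf a0).
Qed.

Lemma axis_diagonal a :
  sumset axis (diagonal_line a) = sumset axis (ray (f (0, a))).
Proof.
have sray (v : V) : subspace (ray v) by exact: ray_subspace.
have sax := axis_subspace.
have sdiag : subspace (diagonal_line a) by apply: sumset_subspace.
have ssum := sumset_subspace sax (sray (f (0, a))).
apply/seteqP; split; apply: sumset_sub; rewrite -/axis => //.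
- by move=> v; exact: sumsetl.
- apply: sumset_sub => //; last by move=> v; exact: sumsetr.
  by move=> _ [s _ <-]; apply: sumsetl => //; rewrite paramZ scaler0; exact/axisE.
- by apply: sumset_subspace.
- by move=> v; exact: sumsetl.
- by move=> v va; apply: sumsetr => //; exact: sumsetr.
Qed.

End Parametrization.

(** * The transversals of a regulus *)

Section Transversals.
Variables (K : unitRingType) (K_div : GRing.field_axiom K) (X V : lmodType K).
Variables (J : choiceType) (x : J -> X) (x_basis : basis x).
Variables (f : {linear (X * X)%type -> V}) (f_inj : injective f).
Implicit Types (A B T : set V) (k : K).

Definition regulus_of : set (set V) :=
  [set axis f] `|` [set slope f (lambda x k) | k in [set: K]].

Lemma regulus_ofE : [set f @` A | A in standard_regulus x] = regulus_of.
Proof.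
have axisE' : f @` [set p | p.2 = 0] = axis f.
  by apply/seteqP; split=> [_ [[y z]/= -> <-]|_ [y _ <-]]; [exists y|exists (y, 0)].
have slopeE' g : f @` [set (g y, y) | y in [set: X]] = slope f g.
  apply/seteqP; split=> [_ [_ [y _ <-] <-]|_ [y _ <-]]; first by exists y.
  by exists (g y, y) => //; exists y.
apply/seteqP; split=> [_ [_ [->|[k _ <-]] <-]|_ [->|[k _ <-]]].
- by left.
- by right; exists k => //; rewrite slopeE'.
- by exists [set p | p.2 = 0] => //; left.
- by eexists; [right; exists k|exact: slopeE'].
Qed.

Lemma regulus_of_axis : regulus_of (axis f).
Proof. by left. Qed.

Lemma regulus_of_slope k : regulus_of (slope f (lambda x k)).
Proof. by right; exists k. Qed.

Lemma regulus_of_subspace A : regulus_of A -> subspace A.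
Proof. by move=> [->|[k _ <-]]; [exact: axis_subspace|exact: slope_subspace]. Qed.

Lemma regulus_of_sub A : regulus_of A -> A `<=` range f.
Proof. by move=> [->|[k _ <-]] _ [y _ <-]; eexists. Qed.

(** Distinct elements of a regulus meet trivially: on a nonzero vector lambda k
and lambda m agree only if k = m. *)
Lemma regulus_of_disjoint A B w :
  regulus_of A -> regulus_of B -> A <> B -> A w -> B w -> w = 0.
Proof.
move=> [->|[k _ <-]] [->|[m _ <-]] // AB [y _ <-].
- by move=> /(slopeE f_inj) ->; rewrite (linear0 (lambda _ _)) (param0 f).
- by move=> /(axisE f_inj) ->; rewrite (linear0 (lambda _ _)) (param0 f).
move=> /(slopeE f_inj); have [->|y0] := eqVneq y 0.
  by rewrite (linear0 (lambda _ _)) (param0 f).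
by move=> /(lambda_inj K_div x_basis y0) km; rewrite km in AB.
Qed.

Lemma diagonal_transversal a : central_vector x a -> a != 0 ->
  transversals (range f) regulus_of (diagonal_line f a).
Proof.
move=> ca a0; have la := line_diagonal K_div f_inj a0; split=> //.
  by move=> w /diagonal_lineP[s [t ->]]; eexists.
move=> A RA; apply: (unique_pointP K_div (line_subspace la) (regulus_of_subspace RA)).2.
case: RA => [->|[k _ <-]].
  exists (f (a, 0)); first by rewrite param_neq0// a0.
  apply/seteqP; split=> [w [/diagonal_lineP[s [t ->]] /(axisE f_inj) ->]|_ [s _ <-]].
    by exists s; rewrite // paramZ scaler0.
  rewrite paramZ scaler0; split; last exact/axisE.
  by apply/diagonal_lineP; exists s, 0; rewrite scale0r.
exists (f (k *: a, a)); first by rewrite param_neq0// a0 orbT.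
apply/seteqP; split=> [w [/diagonal_lineP[s [t ->]] /(slopeE f_inj) ->]|_ [s _ <-]].
  by exists t; rewrite // paramZ linearZ lambda_central.
rewrite paramZ; split; last by apply/slopeE => //; rewrite linearZ lambda_central.
by apply/diagonal_lineP; exists (s * k), s; rewrite scalerA.
Qed.

(** The points in which T meets the axis and the slopes 0 and 1 force T to be a
diagonal line, and the remaining slopes make its direction central. *)
Lemma transversal_diagonal T : transversals (range f) regulus_of T ->
  exists a, [/\ central_vector x a, a != 0 & T = diagonal_line f a].
Proof.
move=> tT; have [lT _ _] := tT; have sT := line_subspace lT.
have meet A : regulus_of A -> exists2 v, v != 0 & T v /\ A v.
  move=> RA; have [v v0 TA] := transversal_meets K_div tT RA (regulus_of_subspace RA).
  by exists v => //; have := ray_id v; rewrite -TA.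
have [wv0 v0 [Tp [p _ pE]]] := meet _ regulus_of_axis; rewrite -pE in v0 Tp.
have [wv1 v1 [Tq [q _ qE]]] := meet _ (regulus_of_slope 0).
rewrite -qE (lambda0 x_basis) in v1 Tq.
have [wv2 v2 [Td [d _ dE]]] := meet _ (regulus_of_slope 1).
rewrite -dE (lambda1 x_basis) in v2 Td.
rewrite !param_neq0// eqxx ?orbF ?orbb in v0 v1 v2.
have TE : T = sumset (ray (f (p, 0))) (ray (f (0, q))).
  apply: line_span2 => //; first by rewrite param_neq0// v0.
  by move=> [k _]; rewrite paramZ scaler0 => /f_inj[_ /esym/eqP]; rewrite (negPf v1).
have [Td1 Td2] : T (f (d, 0)) /\ T (f (0, d)).
  move: Td; rewrite {1}TE => -[_ [s _ <-] [_ [t _ <-]]].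
  rewrite !paramZ paramD !scaler0 addr0 add0r => /f_inj[sd td].
  split; [rewrite -sd|rewrite -td].
    by rewrite -[X in f (_, X)](scaler0 _ s) -paramZ; exact: subspaceZ.
  by rewrite -[X in f (X, _)](scaler0 _ t) -paramZ; exact: subspaceZ.
have TdE := line_diagonalE K_div f_inj lT v2 Td1 Td2.
have [a [ca a0 ad]] : exists a, [/\ central_vector x a, a != 0 & ray a = ray d].
  apply: ray_central => // k.
  have [v v0' [Tv kv]] := meet _ (regulus_of_slope k).
  move: Tv v0' kv; rewrite TdE => /diagonal_lineP[s [t ->]] st0 /(slopeE f_inj) sk.
  have t0 : t != 0.
    apply: contra_neq st0 => t0; rewrite sk t0 scale0r linear0; exact: param0.
  apply: (subspaceZ_inv K_div (ray_subspace d) t0).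
  by rewrite -linearZ -sk; exists s.
exists a; split=> //; apply: line_diagonalE => //.
  have [r _ <-] : ray d a by rewrite -ad; exact: ray_id.
  by rewrite -[X in f (_, X)](scaler0 _ r) -paramZ; exact: subspaceZ.
have [r _ <-] : ray d a by rewrite -ad; exact: ray_id.
by rewrite -[X in f (X, _)](scaler0 _ r) -paramZ; exact: subspaceZ.
Qed.

(** The points of a diagonal line K a * K a are K (k a, a), on the slope k, and
K (a, 0), on the axis. *)
Lemma transversal_cover T w : transversals (range f) regulus_of T -> T w ->
  exists2 A, regulus_of A & A w.
Proof.
move=> /transversal_diagonal[a [ca a0 ->]] /diagonal_lineP[s [t ->]].
have [->|t0] := eqVneq t 0.
  by exists (axis f); [exact: regulus_of_axis|apply/axisE => //; rewrite scale0r].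
exists (slope f (lambda x (t^-1 * s))); first exact: regulus_of_slope.
apply/slopeE => //; rewrite linearZ/= lambda_central// scalerA mulVKr//; exact: K_div.
Qed.

End Transversals.

(** * A regulus is determined by three elements and its transversals *)

Section Uniqueness.
Variables (K : unitRingType) (K_div : GRing.field_axiom K) (X X' V : lmodType K).
Variables (J J' : choiceType) (x : J -> X) (x' : J' -> X').
Hypotheses (x_basis : basis x) (x'_basis : basis x').
Variables (f : {linear (X * X)%type -> V}) (f' : {linear (X' * X')%type -> V}).
Hypotheses (f_inj : injective f) (f'_inj : injective f') (f'f : range f' = range f).

Let R := regulus_of x f.
Let R' := regulus_of x' f'.

Hypotheses (R'_axis : R' (axis f)) (R'_0 : R' (slope f (lambda x 0)))
  (R'_1 : R' (slope f (lambda x 1))).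
Hypothesis R'_transversal : forall z, central_vector x z -> z != 0 ->
  exists2 T, transversals (range f) R' T &
    sumset (axis f) T = sumset (axis f) (ray (f (0, z))).

Lemma axis_rayP z y u : sumset (axis f) (ray (f (0, z))) (f (y, u)) -> exists s, u = s *: z.
Proof.
move=> [_ [v _ <-] [_ [s _ <-]]]; rewrite paramZ paramD => /f_inj[_ <-].
by exists s; rewrite add0r.
Qed.

(** T meets the slope 0 in a multiple of f (0, z) and the slope 1 in a multiple of
f (z, z), because modulo the axis T lies in the ray of f (0, z). *)
Lemma transversal_through z : central_vector x z -> z != 0 ->
  exists T, [/\ transversals (range f) R' T, T `<=` sumset (axis f) (ray (f (0, z))),
    T (f (z, 0)) & T (f (0, z))].
Proof.
move=> cz z0; have [T tT TE] := R'_transversal cz z0; exists T.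
have [lT _ _] := tT; have sT := line_subspace lT.
have Tz : T `<=` sumset (axis f) (ray (f (0, z))).
  by rewrite -TE => w; apply: sumsetr; exact: axis_subspace.
have meet A : R' A -> exists2 v, v != 0 & T v /\ A v.
  move=> RA; have [v v0 TA] := transversal_meets K_div tT RA (regulus_of_subspace RA).
  by exists v => //; have := ray_id v; rewrite -TA.
have [w0 v0 [T0 [u _ uE]]] := meet _ R'_0; rewrite -uE (lambda0 x_basis) in v0 T0.
have [w1 v1 [T1 [v _ vE]]] := meet _ R'_1; rewrite -vE (lambda1 x_basis) in v1 T1.
have [s us] := axis_rayP (Tz _ T0); have [t vt] := axis_rayP (Tz _ T1).
rewrite !param_neq0// eqxx ?orbF ?orbb /= us vt in v0 v1 T0 T1.
have [s0 _] := scaler_neq0 v0; have [t0 _] := scaler_neq0 v1.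
rewrite -[X in f (X, _)](scaler0 _ s) -paramZ in T0.
have Tz0 : T (f (0, z)) := subspaceZ_inv K_div sT s0 T0.
rewrite -paramZ in T1.
have Tzz : T (f (z, z)) := subspaceZ_inv K_div sT t0 T1.
split=> //; have := subspaceB sT Tzz Tz0; by rewrite paramB subr0 subrr.
Qed.

(** Modulo the axis the point of T in A is a nonzero multiple of f (0, z), so after
scaling it is f (v, z); then f (v, 0) lies in T and on the axis, where T has
the single point of f (z, 0). *)
Lemma element_meets_transversal A z : R' A -> A <> axis f ->
  central_vector x z -> z != 0 -> exists k, A (f (k *: z, z)).
Proof.
move=> RA Af cz z0; have [T [tT Tz Tz1 Tz2]] := transversal_through cz z0.
have [lT _ _] := tT; have sT := line_subspace lT; have sA := regulus_of_subspace RA.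
have saxis := axis_subspace f.
have [w w0 TA] := transversal_meets K_div tT RA sA.
have [Tw Aw] : (T `&` A) w by rewrite TA; exact: ray_id.
have [_ [y _ <-] [_ [s _ <-]]] := Tz _ Tw; rewrite paramZ paramD scaler0 addr0 add0r => wE.
have s0 : s != 0.
  apply: contra_neq w0 => s0; apply: (regulus_of_disjoint _ x'_basis f'_inj RA R'_axis Af Aw) => //.
  by rewrite -wE; apply/axisE => //; rewrite s0 scale0r.
have {}wE : s *: f (s^-1 *: y, z) = w.
  by rewrite paramZ scalerA mulrV ?scale1r//; exact: K_div.
rewrite -wE in Tw Aw.
have {Tw} := subspaceZ_inv K_div sT s0 Tw.
have {Aw} := subspaceZ_inv K_div sA s0 Aw; set v := _ *: y => Av Tv.
have Tv0 : T (f (v, 0)).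
  by have := subspaceB sT Tv Tz2; rewrite paramB subr0 subrr.
have [u u0 Tu] := transversal_meets K_div tT R'_axis saxis.
have : ray (f (z, 0)) (f (v, 0)).
  rewrite (@ray_eq _ K_div _ u) ?param_neq0 ?z0 -?Tu//; by split=> //; apply/axisE.
by move=> [k _]; rewrite paramZ scaler0 => /f_inj[kz]; exists k; rewrite kz.
Qed.


(* J is inhabited exactly when X is nonzero. *)
Variable j0 : J.

(** The scalars of [element_meets_transversal] at x j and x j0 both equal the one
at x j + x j0, since A contains no nonzero vector of the axis. *)
Lemma element_slope A : R' A -> A <> axis f ->
  exists k, A = slope f (lambda x k).
Proof.
move=> RA Af; have sA := regulus_of_subspace RA.
have cb := central_basis x; have b0 := basis_neq0 x_basis.
have [k Ak0] := element_meets_transversal RA Af (cb j0) (b0 j0).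
have meet0 y : A (f (y, 0)) -> y = 0.
  move=> Ay; apply/eqP; have := regulus_of_disjoint K_div x'_basis f'_inj RA R'_axis Af Ay.
  move=> /(_ (ex_intro2 _ _ y I erefl))/eqP; apply: contraTT => y0.
  by rewrite param_neq0// y0.
have Ak j : A (f (k *: x j, x j)).
  have [->//|jj0] := eqVneq j j0.
  have [m Am] := element_meets_transversal RA Af (cb j) (b0 j).
  have xx0 : x j + x j0 != 0.
    apply: contra_neq (oner_neq0 K) => xx; apply: (basis_scale_eq x_basis jj0 (m := -1)).
    by rewrite scale1r scaleN1r; apply/eqP; rewrite -addr_eq0 xx.
  have [n An] := element_meets_transversal RA Af (centralD (cb j) (cb j0)) xx0.
  have := subspaceB sA (subspaceD sA Am Ak0) An; rewrite paramD paramB subrr.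
  move=> /meet0/eqP; rewrite scalerDr opprD addrACA -!scalerBl addr_eq0 -scaleNr => /eqP mn.
  have mn0 := basis_scale_eq x_basis jj0 mn.
  have kn0 : - (k - n) = 0.
    by apply: (basis_scale_eq x_basis (i := j0) (j := j)); [rewrite eq_sym|exact: esym mn].
  move/eqP: kn0; rewrite oppr_eq0 subr_eq0 => /eqP ->.
  by move/eqP: mn0; rewrite subr_eq0 => /eqP <-.
exists k; apply/seteqP.
pose g u := f (lambda x k u, u).
have g_lin : linear g by move=> a u v; rewrite /g paramZ paramD linearP.
pose G : {linear X -> V} := HB.pack g (GRing.isLinear.Build K X V *:%R g g_lin).
have sub u : A (f (lambda x k u, u)).
  by apply: (linear_basis_sub (g := G) x_basis sA) => j /=; rewrite /g lambdaE.
split=> [w Aw|_ [u _ <-]]; last exact: sub.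
have : range f w by rewrite -f'f; exact: (regulus_of_sub RA).
case=> -[y u] _ wE; rewrite -wE in Aw *; apply/slopeE => //.
have := subspaceB sA Aw (sub u); rewrite paramB subrr => /meet0/eqP.
by rewrite subr_eq0 => /eqP.
Qed.

(** The inclusion of [regulus_of x f] in [R'] uses one transversal: it is covered
by the elements of [R'], and each of its points lies on only one slope. *)
Theorem regulus_of_unique : R' = R.
Proof.
apply/seteqP; split=> [A RA|_ [->//|[k _ <-]]].
  have [->|/eqP Af] := eqVneq A (axis f); first exact: regulus_of_axis.
  by have [k ->] := element_slope RA Af; exact: regulus_of_slope.
have b0 := basis_neq0 x_basis j0.
have [T [tT Tz Tz1 Tz2]] := transversal_through (central_basis x j0) b0.
have sT := line_subspace (let: And3 l _ _ := tT in l).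
have Tk : T (f (k *: x j0, x j0)).
  have := subspaceD sT (subspaceZ k sT Tz1) Tz2.
  by rewrite paramZ paramD scaler0 addr0 add0r.
rewrite -f'f in tT.
have [A RA Aw] := transversal_cover K_div x'_basis f'_inj tT Tk.
have Af : A <> axis f.
  by move=> AE; move: Aw b0; rewrite AE => /(axisE f_inj) ->; rewrite eqxx.
have [m AE] := element_slope RA Af.
move: Aw; rewrite AE => /(slopeE f_inj); rewrite -(lambdaE _ _ x_basis).
by move=> /(lambda_inj K_div x_basis b0) ->; rewrite -AE.
Qed.

End Uniqueness.

(** * The parametrization of im alpha + U *)

Section GraphParam.
Variables (K : unitRingType) (V : lmodType K).

Lemma vec_linear (S : submodClosed V) : linear (@vec K V S).
Proof. exact: (linearP (val : subvect S -> V)). Qed.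

Lemma vec0 (S : submodClosed V) : vec (0 : subvect S) = 0.
Proof. exact: (linear0 (val : subvect S -> V)). Qed.

Lemma vec_surj (S : submodClosed V) v : v \in S -> exists u : subvect S, vec u = v.
Proof. by move=> vS; exists (SubVect vS). Qed.

Variables (W U : submodClosed V) (alpha : {linear subvect U -> subvect W}).

Definition graph_param (p : (subvect U * subvect U)%type) : V :=
  vec (alpha p.1) + vec p.2.

Lemma graph_paramE u v : graph_param (u, v) = vec (alpha u) + vec v.
Proof. by []. Qed.

Lemma graph_param_linear : linear graph_param.
Proof.
move=> k [p1 p2] [q1 q2]; rewrite /graph_param /= linearP (vec_linear (S := W)).
rewrite -[X in _ + X]/(vec (k *: p2 + q2)) (vec_linear (S := U)).
by rewrite scalerDr addrACA.
Qed.

HB.instance Definition _ :=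
  GRing.isLinear.Build K (subvect U * subvect U)%type V *:%R graph_param
    graph_param_linear.

Lemma graph_param_inj : [set` W] `&` [set` U] = [set 0] -> injective alpha ->
  injective graph_param.
Proof.
move=> WU alpha_inj; apply: raddf_inj => -[u v] fuv0.
have uv0 : vec (alpha u) + vec v = 0 := fuv0.
have : ([set` W] `&` [set` U]) (vec v).
  split; last exact: vecP.
  move/eqP: uv0; rewrite addrC addr_eq0 => /eqP ->; rewrite /= -scaleN1r.
  by apply: rpredZ; exact: vecP.
rewrite WU /= => v0; rewrite v0 addr0 in uv0.
have -> : v = 0 by apply: val_inj; exact: etrans v0 (esym (vec0 U)).
suff -> : u = 0 by [].
apply: alpha_inj; apply: val_inj; rewrite linear0; exact: etrans uv0 (esym (vec0 W)).
Qed.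

Lemma graph_param_axis : axis graph_param = im alpha.
Proof.
have fE u : graph_param (u, 0) = vec (alpha u) by rewrite graph_paramE vec0 addr0.
by apply/seteqP; split=> _ [u _ <-]; exists u.
Qed.

Lemma graph_param_slope g : slope graph_param g = graph (alpha \o g).
Proof. by apply/seteqP; split=> _ [u _ <-]; exists u. Qed.

Lemma graph_param_range : range graph_param = sumset (im alpha) [set` U].
Proof.
apply/seteqP; split=> [_ [[u v] _ <-]|_ [_ [u _ <-] [v /= /vec_surj[{}v <-] <-]]].
  by exists (vec (alpha u)); [exists u|exists (vec v) => //; exact: vecP].
by exists (u, v).
Qed.

Variables (I : choiceType) (b : I -> subvect U) (b_basis : basis b).

Lemma graph_param_slope0 : slope graph_param (lambda b 0) = [set` U].
Proof.
rewrite graph_param_slope; apply/seteqP; split=> [_ [u _ <-]|v /= /vec_surj[u <-]].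
  by rewrite /= (lambda0 b_basis) linear0 vec0 add0r; exact: vecP.
by exists u; rewrite //= (lambda0 b_basis) linear0 vec0 add0r.
Qed.

Lemma graph_param_slope1 : slope graph_param (lambda b 1) = graph alpha.
Proof.
rewrite graph_param_slope.
by apply/seteqP; split=> _ [u _ <-]; exists u; rewrite //= (lambda1 b_basis).
Qed.

Lemma graph_param_regulus :
  ell b alpha `|` [set im alpha] = regulus_of b graph_param.
Proof.
rewrite /regulus_of graph_param_axis setUC; apply: congr1.
by apply/seteqP; split=> _ [k _ <-]; exists k; rewrite ?graph_param_slope.
Qed.

Lemma central_pointsE P : central_points b P <->
  exists z, [/\ central_vector b z, z != 0 & P = ray (graph_param (0, z))].
Proof.
have rE z : ray (graph_param (0, z)) = [set k *: vec z | k in [set: K]].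
  by rewrite graph_paramE linear0 vec0 add0r.
split=> [[c [fc cc] [/eqP c0 ->]]|[z [[c fc <-] z0 ->]]].
  by exists (lincomb b c); split=> //; exists c.
by exists c => //; split; [exact/eqP|rewrite rE].
Qed.

End GraphParam.

Theorem proposition4p6 (K : unitRingType) (K_div : GRing.field_axiom K)
  (V : lmodType K) (W U : submodClosed V)
  (W_neq0 : [set` W] <> [set 0]) (W_neqV : [set` W] <> [set: V])
  (WU_inter : [set` W] `&` [set` U] = [set 0])
  (WU_sum : sumset [set` W] [set` U] = [set: V])
  (I : choiceType) (b : I -> subvect U) (b_basis : basis b)
  (alpha : {linear subvect U -> subvect W}) (alpha_inj : injective alpha) :
  let Y := sumset (im alpha) [set` U] in
  let associated := fun R : set (set V) =>
    [/\ regulus Y R,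
        R (im alpha) /\ R [set` U] /\ R (graph alpha) &
        [set sumset (im alpha) T | T in transversals Y R] =
        [set sumset (im alpha) P | P in central_points b]] in
  affine_regulus Y (im alpha) (ell b alpha) /\
  unique associated (ell b alpha `|` [set im alpha]).
Proof.
move=> Y associated; pose f : {linear (subvect U * subvect U)%type -> V} := graph_param alpha.
have f_inj : injective f by exact: graph_param_inj.
have imE : im alpha = axis f by rewrite -graph_param_axis.
have slope0 : [set` U] = slope f (lambda b 0) by rewrite -(graph_param_slope0 alpha b_basis).
have slope1 : graph alpha = slope f (lambda b 1) by rewrite -(graph_param_slope1 alpha b_basis).
have YE : Y = range f by apply: esym; exact: graph_param_range.
have RE : ell b alpha `|` [set im alpha] = regulus_of b f by exact: graph_param_regulus.
have centralE P : central_points b P <->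
    exists z, [/\ central_vector b z, z != 0 & P = ray (f (0, z))].
  exact: central_pointsE.
have [u u0] : exists u : subvect U, u != 0.
  apply: contrapT => U0; apply: W_neqV; rewrite -WU_sum.
  apply/seteqP; split=> [w Ww|_ [w Ww [v /= /vec_surj[u <-] <-]]].
    by exists w => //; exists 0; rewrite ?addr0//= rpred0.
  have -> : u = 0 by apply/eqP; case: eqVneq => // u0; case: U0; exists u.
  by rewrite vec0 addr0.
have regR : regulus Y (ell b alpha `|` [set im alpha]).
  exists (subvect U), I, b, f; split=> //; last by rewrite regulus_ofE.
  move=> U0; have /eqP : [set 0] u by rewrite -U0.
  by rewrite (negPf u0).
(* The graph of a map to W contains a vector outside W as soon as U is nonzero. *)
have im_notin_ell : ~ ell b alpha (im alpha).
  move=> [k _ kE]; have : slope f (lambda b k) (f (lambda b k u, u)) by exists u.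
  rewrite graph_param_slope kE imE => /(axisE f_inj) uE.
  by rewrite uE eqxx in u0.
split.
  exists (ell b alpha `|` [set im alpha]); split=> //; first by right.
  apply/seteqP; split=> [A lA|A [[]//]].
  by split; [left|move=> AE; apply: im_notin_ell; rewrite -AE].
split.
  split=> //.
    rewrite RE imE slope0 slope1; split; first exact: regulus_of_axis.
    by split; exact: regulus_of_slope.
  rewrite RE YE imE.
  apply/seteqP; split=> [_ [T tT <-]|_ [P /centralE[z [cz z0 ->]] <-]].
    have [a [ca a0 ->]] := transversal_diagonal K_div b_basis f_inj tT.
    by rewrite (axis_diagonal f_inj); exists (ray (f (0, a))) => //; apply/centralE; exists a.
  by exists (diagonal_line f z); [exact: diagonal_transversal|exact: (axis_diagonal f_inj)].
move=> R [[X' [J' [x' [f' [X'0 x'_basis f'_inj f'Y RE']]]]] [Rim [RU Rg]] RT].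
rewrite RE; rewrite regulus_ofE in RE'; rewrite {}RE' imE slope0 slope1 in Rim RU Rg RT *.
have [c fc cu] := coordsP b_basis u.
have [j0 _] := coord_neq0 fc cu u0.
apply/esym/regulus_of_unique => //; first by rewrite f'Y YE.
move=> z cz z0.
have : [set sumset (axis f) P | P in central_points b] (sumset (axis f) (ray (f (0, z)))).
  by exists (ray (f (0, z))) => //; apply/centralE; exists z.
by rewrite -RT YE => -[T tT TE]; exists T.
Qed.
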